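(* Let $n\ge 2$. For every unitarily invariant norm $\|\cdot\|$ on $\mathbb{M}_n$ and every $Z\in\mathbb{M}_n$, $$\frac{\sqrt2}{2}\,\bigl\||Z|\bigr\|\ \le\ \bigl\||Z|_{\mathrm{qsym}}\bigr\|\ \le\ \sqrt2\,\bigl\||Z|\bigr\|.$$ Moreover, both constants $\frac{\sqrt2}{2}$ and $\sqrt2$ are sharp: if $c$ is a real number such that $c\,\||Z|\|\le \||Z|_{\mathrm{qsym}}\|$ for every unitarily invariant norm on $\mathbb{M}_n$ and every $Z\in\mathbb{M}_n$, then $c\le \frac{\sqrt2}{2}$; and if $C$ is a real number such that $\||Z|_{\mathrm{qsym}}\|\le C\,\||Z|\|$ for every unitarily invariant norm on $\mathbb{M}_n$ and every $Z\in\mathbb{M}_n$, then $C\ge \sqrt2$.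
   Context: $\mathbb{M}_n$ is the set of $n\times n$ complex matrices and $Z^*$ is the conjugate transpose of $Z$. The usual modulus is $|Z|:=(Z^*Z)^{1/2}$, and the quadratic symmetric modulus is $|Z|_{\mathrm{qsym}}:=\left(\frac{|Z|^2+|Z^*|^2}{2}\right)^{1/2}$. A norm $\|\cdot\|$ on $\mathbb{M}_n$ is unitarily invariant if $\|UZV\|=\|Z\|$ for all $Z\in\mathbb{M}_n$ and all unitaries $U,V\in\mathbb{M}_n$. *)

(* Defs.v *)
From mathcomp Require Import all_boot all_order all_algebra.
From mathcomp Require Import reals.
From mathcomp.real_closed Require Import complex.

Set Implicit Arguments.
Unset Strict Implicit.
Unset Printing Implicit Defensive.

Import Order.TTheory GRing.Theory Num.Theory.
Local Open Scope ring_scope.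
Local Open Scope sesquilinear_scope.
Local Open Scope complex_scope.

Section MatrixSqrt.
Context {C : numClosedFieldType} {n : nat}.
Implicit Types A B Z : 'M[C]_n.

Definition psdmx A : Prop :=
  A ^t* = A /\ forall u : 'rV[C]_n, 0 <= (u *m A *m u ^t*) 0 0.

(* Spectral functional calculus; [spectralmx A] is a unitary matrix
   diagonalizing A when A is normal. It is the square root meant in the
   mathematics only when [psdmx A], see [mxsqrt_psd], [mxsqrt_sqr] and
   [mxsqrt_uniq]; for other A the value is irrelevant. *)
Definition mxsqrt A : 'M[C]_n :=
  invmx (spectralmx A) *m diag_mx (map_mx sqrtC (spectral_diag A))
    *m spectralmx A.

Definition mxmod Z : 'M[C]_n := mxsqrt (Z ^t* *m Z).

Definition mxqsym Z : 'M[C]_n :=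
  mxsqrt (2^-1 *: (mxmod Z *m mxmod Z + mxmod (Z ^t*) *m mxmod (Z ^t*))).

Lemma psdmx_normal A : psdmx A -> A \is normalmx.
Proof. by case=> hA _; apply/normalmxP; rewrite hA. Qed.

Lemma psdmx_spectral_ge0 A : psdmx A -> forall i, 0 <= spectral_diag A 0 i.
Proof.
move=> psdA i; have /orthomx_spectralP eA := psdmx_normal psdA.
have [_ /(_ (delta_mx 0 i *m spectralmx A))] := psdA.
have Uu := spectral_unitarymx A.
set P := spectralmx A in eA Uu *; set d := spectral_diag A in eA *.
rewrite {1}eA trmx_mul map_mxM -!mulmxA.
rewrite (mulmxA P (invmx P)) mulmxV ?unitarymx_unit // mul1mx.
rewrite (mulmxA P (P ^t*)) (unitarymxP Uu) mul1mx.
rewrite mulmxA -rowE row_diag_mx -scalemxAl mxE.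
rewrite trmx_delta map_delta_mx mul_delta_mx.
by rewrite !mxE !eqxx /= mulr1.
Qed.

Lemma psdmx_unitary_diag (P : 'M[C]_n) (d : 'rV[C]_n) :
  P \is unitarymx -> (forall i, 0 <= d 0 i) ->
  psdmx (invmx P *m diag_mx d *m P).
Proof.
move=> Pu d0; rewrite invmx_unitary //; split.
  rewrite !trmx_mul !map_mxM trmxCK mulmxA; congr (_ *m _ *m _).
  apply/matrixP=> i j; rewrite !mxE rmorphMn /= eq_sym.
  by case: eqP => [->|]; rewrite ?mulr0n // geC0_conj.
move=> u; pose v := u *m P ^t*.
have -> : u *m (P ^t* *m diag_mx d *m P) *m u ^t* = v *m diag_mx d *m v ^t*.
  by rewrite /v trmx_mul map_mxM trmxCK !mulmxA.
rewrite mul_mx_diag mxE sumr_ge0 // => i _.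
by rewrite !mxE mulrAC mulr_ge0 ?mul_conjC_ge0.
Qed.

Lemma mxsqrt_psd A : psdmx A -> psdmx (mxsqrt A).
Proof.
move=> psdA; apply: psdmx_unitary_diag; first exact: spectral_unitarymx.
by move=> i; rewrite mxE sqrtC_ge0 psdmx_spectral_ge0.
Qed.

Lemma unitary_diag_sqr (P : 'M[C]_n) (d : 'rV[C]_n) : P \is unitarymx ->
  let B := invmx P *m diag_mx d *m P in
  B *m B = invmx P *m diag_mx (map_mx (fun x => x ^+ 2) d) *m P.
Proof.
move=> Pu /=; rewrite -!mulmxA (mulmxA P (invmx P)).
rewrite mulmxV ?unitarymx_unit // mul1mx (mulmxA (diag_mx d)) mulmx_diag.
by congr (_ *m (diag_mx _ *m _)); apply/rowP=> i; rewrite !mxE expr2.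
Qed.

Lemma mxsqrt_sqr A : psdmx A -> mxsqrt A *m mxsqrt A = A.
Proof.
move=> psdA; rewrite unitary_diag_sqr ?spectral_unitarymx //.
have /orthomx_spectralP eA := psdmx_normal psdA; rewrite [RHS]eA.
by congr (_ *m diag_mx _ *m _); apply/rowP=> i; rewrite !mxE sqrtCK.
Qed.

Lemma psdmx_sqr_inj A B : psdmx A -> psdmx B -> A *m A = B *m B -> A = B.
Proof.
move=> psdA psdB.
have /orthomx_spectralP eA := psdmx_normal psdA.
have /orthomx_spectralP eB := psdmx_normal psdB.
have a0 := psdmx_spectral_ge0 psdA; have b0 := psdmx_spectral_ge0 psdB.
have Pu := spectral_unitarymx A; have Qu := spectral_unitarymx B.
set P := spectralmx A in eA Pu; set a := spectral_diag A in eA a0.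
set Q := spectralmx B in eB Qu; set b := spectral_diag B in eB b0.
have PU := unitarymx_unit Pu; have QU := unitarymx_unit Qu.
have tr (x y : 'rV[C]_n) :
    invmx P *m diag_mx x *m P = invmx Q *m diag_mx y *m Q <->
    diag_mx x *m (P *m invmx Q) = P *m invmx Q *m diag_mx y.
  split=> e.
    move/(congr1 (fun M => P *m M *m invmx Q)): e.
    by rewrite !mulmxA mulmxV // mul1mx mulmxK.
  move/(congr1 (fun M => invmx P *m M *m Q)): e.
  by rewrite !mulmxA mulVmx // mul1mx mulmxKV.
rewrite {1 2}eA {1 2}eB !unitary_diag_sqr // => /tr e.
rewrite eA eB; apply/tr; move: (P *m invmx Q) e => W e.
apply/matrixP=> i j.
have := congr1 (fun M : 'M[C]_n => M i j) e.
rewrite /= !mul_diag_mx !mul_mx_diag !mxE.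
have [->|w0] := eqVneq (W i j) 0; first by rewrite !(mulr0, mul0r).
rewrite [in RHS]mulrC => /(mulIf w0)/eqP; rewrite eqrXn2 // => /eqP ->.
by rewrite mulrC.
Qed.

Lemma mxsqrt_uniq A B : psdmx A -> psdmx B -> B *m B = A -> B = mxsqrt A.
Proof.
move=> psdA psdB e; apply: psdmx_sqr_inj => //; first exact: mxsqrt_psd.
by rewrite mxsqrt_sqr.
Qed.

Lemma psdmx_gram Z : psdmx (Z ^t* *m Z).
Proof.
split=> [|u]; first by rewrite trmx_mul map_mxM trmxCK.
have -> : u *m (Z ^t* *m Z) *m u ^t* = (u *m Z ^t*) *m (u *m Z ^t*) ^t*.
  by rewrite trmx_mul map_mxM trmxCK !mulmxA.
by rewrite mxE sumr_ge0 // => i _; rewrite !mxE mul_conjC_ge0.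
Qed.

Lemma psdmx_qsym Z :
  psdmx (2^-1 *: (mxmod Z *m mxmod Z + mxmod (Z ^t*) *m mxmod (Z ^t*))).
Proof.
rewrite !mxsqrt_sqr; try exact: psdmx_gram.
have [h1 p1] := psdmx_gram Z; have [h2 p2] := psdmx_gram (Z ^t*).
split=> [|u].
  by rewrite linearZ linearD /= map_mxZ map_mxD h1 h2 fmorphV rmorph_nat.
rewrite -scalemxAr -scalemxAl mulmxDr mulmxDl mxE [X in _ * X]mxE.
by rewrite mulr_ge0 ?invr_ge0 ?ler0n // addr_ge0.
Qed.

End MatrixSqrt.

Record is_norm (R : realType) (n : nat) (N : 'M[R[i]]_n -> R) : Prop := IsNorm {
  norm_ge0 : forall Z, 0 <= N Z;
  norm_eq0 : forall Z, N Z = 0 -> Z = 0;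
  norm_scale : forall (a : R[i]) Z, (N (a *: Z))%:C = `|a| * (N Z)%:C;
  norm_triangle : forall Z W, N (Z + W) <= N Z + N W }.

Definition unitarily_invariant (R : realType) (n : nat)
    (N : 'M[R[i]]_n -> R) : Prop :=
  forall Z U V : 'M[R[i]]_n, U \is unitarymx -> V \is unitarymx ->
    N (U *m Z *m V) = N Z.

(* Main.v *)
Require Import Defs.
From mathcomp Require Import all_boot all_order all_algebra.
From mathcomp Require Import boolp classical_sets reals.
From mathcomp.real_closed Require Import complex.
From mathcomp Require Import ring lra.
Local Open Scope ring_scope.
Import Order.TTheory GRing.Theory Num.Theory ComplexField.Normc.

(** A unitarily invariant norm [N] does not increase when its argument is
    multiplied on either side by a contraction, because a contraction is, up to
    a perturbation that makes it invertible, the mean of two unitary matrices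
    ([contraction_unitary_mean], [nearly_unitary_mean_mull],
    [nearly_unitary_mean_mulr]). Both inequalities then reduce to
    factorizations with contractive factors.

    Let [T = sqrt 2 |Z|_qsym], so that [T^2 = Z^* Z + Z Z^*] is the Gram matrix
    of [Z] stacked over its adjoint. Polar decomposition of the stacked matrix
    ([douglas_factorization]) gives contractions [K], [L] with [Z = K T] and
    [T = K^* Z + L^* Z^*]. The first identity gives [N Z <= N T], the second
    [N T <= 2 N Z] once [Z] and its adjoint are known to have the same norm as
    [|Z|], or at most that. This is the same factorization with one block,
    [Z = K |Z|] and [|Z| = K^* Z].

    For sharpness let [Z] be the matrix unit [E_12]: then [|Z| = E_22] and
    [|Z|_qsym = (E_11 + E_22) / sqrt 2]. The operator norms of these two matrices
    are 1 and [1 / sqrt 2], their trace norms 1 and [sqrt 2], so the operator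
    norm attains the lower constant and the trace norm the upper one. Both norms
    are built as suprema of [|tr (K Z)|] over a set of matrices [K]
    ([dual_norm]). *)

(** * Matrices over a closed field with conjugation *)

Section Matrices.
Set Implicit Arguments.
Unset Strict Implicit.
Local Open Scope sesquilinear_scope.
Context {C : numClosedFieldType} {n : nat}.
Implicit Types A K L T U X Y Z : 'M[C]_n.

(** The operator norm of [K] is at most 1, phrased without that norm. *)
Definition contraction K : Prop := psdmx (1%:M - K ^t* *m K).

(** ** Adjoints and positive semidefinite matrices *)

Lemma trmxCM A K : (A *m K) ^t* = K ^t* *m A ^t*.
Proof. by rewrite trmx_mul map_mxM. Qed.

Lemma trmxCD A K : (A + K) ^t* = A ^t* + K ^t*.
Proof. by rewrite linearD map_mxD. Qed.

Lemma trmxCB A K : (A - K) ^t* = A ^t* - K ^t*.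
Proof. by rewrite linearB map_mxB. Qed.

Lemma trmxCZ a A : (a *: A) ^t* = a^* *: A ^t*.
Proof. by rewrite linearZ /= map_mxZ. Qed.

Lemma trmxC1 : (1%:M : 'M[C]_n) ^t* = 1%:M.
Proof. by rewrite trmx1 map_mx1. Qed.

Lemma psdmxD A K : psdmx A -> psdmx K -> psdmx (A + K).
Proof.
move=> [hA pA] [hK pK]; split=> [|u]; first by rewrite trmxCD hA hK.
by rewrite mulmxDr mulmxDl mxE addr_ge0.
Qed.

Lemma psdmxZ a A : 0 <= a -> psdmx A -> psdmx (a *: A).
Proof.
move=> a0 [hA pA]; split=> [|u]; first by rewrite trmxCZ hA geC0_conj.
by rewrite -scalemxAr -scalemxAl mxE mulr_ge0.
Qed.

Lemma psdmx_conj A K : psdmx A -> psdmx (K *m A *m K ^t*).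
Proof.
move=> [hA pA]; split=> [|u]; first by rewrite !trmxCM trmxCK hA mulmxA.
have := pA (u *m K); rewrite trmx_mul map_mxM.
by rewrite !mulmxA.
Qed.

Lemma psdmx_diag_ge0 A i : psdmx A -> 0 <= A i i.
Proof.
move=> [_ /(_ (delta_mx 0 i))].
by rewrite -rowE trmx_delta map_delta_mx -colE !mxE.
Qed.

Lemma gram_diag m (X : 'M[C]_(m, n)) j : (X ^t* *m X) j j = \sum_i `|X i j| ^+ 2.
Proof.
by rewrite mxE; apply: eq_bigr => i _; rewrite !mxE normCK mulrC.
Qed.

Lemma gramD_eq0 X Y : X ^t* *m X + Y ^t* *m Y = 0 -> X = 0.
Proof.
move=> e; apply/matrixP => i j.
have := congr1 (fun M : 'M[C]_n => M j j) e; rewrite mxE !gram_diag mxE => /eqP.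
rewrite paddr_eq0 ?sumr_ge0 // => [/andP[+ _]||]; rewrite ?exprn_ge0 //.
  rewrite psumr_eq0 => [/allP/(_ i)|k _]; last by rewrite exprn_ge0.
  by rewrite mem_index_enum sqrf_eq0 normr_eq0 mxE => /(_ isT)/eqP.
all: by move=> *; rewrite exprn_ge0.
Qed.

(** ** Factorization through a square root *)

(** Inverting the nonzero eigenvalues of [T] only; in [GRing.inv] the inverse
    of 0 is 0, which is what makes the map on eigenvalues uniform. *)
Lemma psdmx_pseudo_inverse T : psdmx T ->
  exists G, [/\ G ^t* = G, T *m G *m T = T & G *m T = T *m G].
Proof.
move=> psdT; have /orthomx_spectralP eT := psdmx_normal psdT.
have d0 := psdmx_spectral_ge0 psdT.
have Pu := spectral_unitarymx T.
set P := spectralmx T in eT Pu; set d := spectral_diag T in eT d0.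
pose f (x y : 'rV[C]_n) := map2_mx *%R x y.
have fM (x y : 'rV[C]_n) :
    (invmx P *m diag_mx x *m P) *m (invmx P *m diag_mx y *m P) =
    invmx P *m diag_mx (f x y) *m P.
  rewrite -!mulmxA (mulmxA P (invmx P)) mulmxV ?unitarymx_unit // mul1mx.
  rewrite (mulmxA (diag_mx x)) mulmx_diag.
  by congr (_ *m (diag_mx _ *m _)); apply/rowP=> i; rewrite !mxE.
exists (invmx P *m diag_mx (map_mx GRing.inv d) *m P); rewrite {}eT.
split.
- have [] // := @psdmx_unitary_diag _ _ P (map_mx GRing.inv d) Pu.
  by move=> i; rewrite mxE invr_ge0.
- rewrite !fM; congr (_ *m diag_mx _ *m _); apply/rowP=> i; rewrite !mxE.
  by have [->|?] := eqVneq (d 0 i) 0; rewrite ?mulr0 // divff ?mul1r.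
- by rewrite !fM; congr (_ *m diag_mx _ *m _); apply/rowP=> i; rewrite !mxE mulrC.
Qed.

(** Polar decomposition of the stacked matrix [X; Y], whose modulus is [T]:
    its polar factor is an isometry on the range of [T], with blocks [K] and
    [L]. With [G] the pseudo-inverse of [T], take [K = X G] and [L = Y G]; then
    [K^* K + L^* L = G T^2 G] is the orthogonal projection [Q] on the range of
    [T], so each of [K^* K] and [L^* L] is at most 1. The identities
    [X = K T] and [Y = L T] say that [X] and [Y] vanish where [T] does. *)
Lemma douglas_factorization T X Y :
  psdmx T -> T *m T = X ^t* *m X + Y ^t* *m Y ->
  exists K L, [/\ contraction K, contraction L, X = K *m T, Y = L *m T &
    T = K ^t* *m X + L ^t* *m Y].
Proof.
move=> psdT eT; have [G [hG TGT GT]] := psdmx_pseudo_inverse psdT.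
have [hT _] := psdT; pose Q := G *m T.
have hQ : Q ^t* = Q by rewrite trmxCM hT hG -GT.
have QQ : Q *m Q = Q by rewrite /Q -mulmxA (mulmxA T) TGT.
have TQ : T *m Q = T by rewrite /Q mulmxA.
have GTTG : G *m (T *m T) *m G = Q by rewrite /Q mulmxA -mulmxA -GT QQ.
(* The Gram matrices of [X' (1 - Q)] and [Y' (1 - Q)] add up to 0. *)
have ker X' Y' : T *m T = X' ^t* *m X' + Y' ^t* *m Y' -> X' *m Q = X'.
  move=> e; apply/eqP; rewrite eq_sym -subr_eq0 -[X in X - _]mulmx1 -mulmxBr.
  apply/eqP/(@gramD_eq0 _ (Y' *m (1%:M - Q))).
  rewrite !trmxCM -!mulmxA -mulmxDr !(mulmxA _ _ (1%:M - Q)) -mulmxDl -e.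
  by rewrite -mulmxA mulmxBr mulmx1 TQ subrr !mulmx0.
(* [1 - (X' G)^* (X' G) = (1 - Q) + (Y' G)^* (Y' G)], and [1 - Q] is its own
   Gram matrix. *)
have ctr X' Y' : T *m T = X' ^t* *m X' + Y' ^t* *m Y' -> contraction (X' *m G).
  move=> e; rewrite /contraction.
  have -> : 1%:M - (X' *m G) ^t* *m (X' *m G) =
      (1%:M - Q) ^t* *m (1%:M - Q) + (Y' *m G) ^t* *m (Y' *m G).
    have -> : (Y' *m G) ^t* *m (Y' *m G) = Q - (X' *m G) ^t* *m (X' *m G).
      apply/eqP; rewrite eq_sym subr_eq addrC !trmxCM hG -!mulmxA -mulmxDr.
      by rewrite !(mulmxA _ _ G) -mulmxDl -e mulmxA GTTG.
    rewrite trmxCB trmxC1 hQ !(mulmxBr, mulmxBl, mulmx1, mul1mx) QQ.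
    by rewrite subrr subr0 addrA subrK.
  by apply: psdmxD; apply: psdmx_gram.
have eT' : T *m T = Y ^t* *m Y + X ^t* *m X by rewrite addrC.
exists (X *m G), (Y *m G); split.
- exact: ctr eT.
- exact: ctr eT'.
- by rewrite -mulmxA (ker _ _ eT).
- by rewrite -mulmxA (ker _ _ eT').
- by rewrite !trmxCM hG -!mulmxA -mulmxDr -eT mulmxA GT TGT.
Qed.

(** ** Contractions as means of two unitary matrices *)

Lemma unitarymx_trmxCmul U : U \is unitarymx -> U ^t* *m U = 1%:M.
Proof. by move=> Uu; rewrite -invmx_unitary // mulVmx ?unitarymx_unit. Qed.

Lemma unitarymx_trmxC U : U \is unitarymx -> U ^t* \is unitarymx.
Proof. by rewrite trmxC_unitary. Qed.

Lemma unitary_diag_mx (d : 'rV[C]_n) :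
  (forall i, `|d 0 i| = 1) -> diag_mx d \is unitarymx.
Proof.
move=> d1; apply/unitarymxP/matrixP => i j.
rewrite mul_diag_mx !mxE eq_sym; case: eqP => [->|_]; last first.
  by rewrite !mulr0n rmorph0 mulr0.
by rewrite !mulr1n -normCK d1 expr1n.
Qed.

(** Singular values [s] in [[0, 1]] are real parts of the unimodular numbers
    [s + i sqrt (1 - s^2)] and [s - i sqrt (1 - s^2)]. The singular value
    decomposition [K = V diag(s) P] comes from diagonalizing [K^* K];
    invertibility makes [V = K P^* diag(s)^-1] unitary. *)
Lemma contraction_unitary_mean K : contraction K -> K \in unitmx ->
  exists U V, [/\ U \is unitarymx, V \is unitarymx &
    K = 2^-1 *: (U + V)].
Proof.
move=> cK Ku.
have /psdmx_normal/orthomx_spectralP := psdmx_gram K.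
have Pu := spectral_unitarymx (K ^t* *m K).
move: (spectralmx _) (spectral_diag _) Pu => P e Pu eK.
have PP : P *m P ^t* = 1%:M by apply/unitarymxP.
have P'P : P ^t* *m P = 1%:M by apply: unitarymx_trmxCmul.
pose M := K *m P ^t*.
have MM : M ^t* *m M = diag_mx e.
  rewrite trmxCM trmxCK -!mulmxA (mulmxA (K ^t*)) eK invmx_unitary //.
  by rewrite -!mulmxA PP mulmx1 mulmxA PP mul1mx.
have Mu : M \in unitmx.
  by rewrite unitmx_mul Ku unitarymx_unit // trmxC_unitary.
have e0 i : 0 <= e 0 i.
  have := psdmx_diag_ge0 i (psdmx_gram M).
  by rewrite MM mxE eqxx mulr1n.
have e1 i : e 0 i <= 1.
  have := psdmx_diag_ge0 i (psdmx_conj P cK).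
  rewrite mulmxBr mulmx1 mulmxBl PP.
  have -> : P *m (K ^t* *m K) *m P ^t* = M ^t* *m M.
    by rewrite trmxCM trmxCK !mulmxA.
  by rewrite MM !mxE eqxx !mulr1n subr_ge0.
have en0 i : e 0 i != 0.
  have : diag_mx e \in unitmx.
    rewrite -MM unitmx_mul Mu andbT unitmxE det_map_mx det_tr unitfE fmorph_eq0.
    by move: Mu; rewrite unitmxE unitfE.
  rewrite unitmxE det_diag unitfE => /prodf_neq0; exact.
have [s [sr sE sn0]] : exists s : 'rV[C]_n, [/\ forall i, s 0 i \is Num.real,
    forall i, s 0 i * s 0 i = e 0 i & forall i, s 0 i != 0].
  exists (map_mx sqrtC e); split=> i; rewrite mxE.
  - by rewrite ger0_real ?sqrtC_ge0.
  - by rewrite -expr2 sqrtCK.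
  - by rewrite sqrtC_eq0.
pose V := M *m diag_mx (map_mx GRing.inv s).
have hD : (diag_mx (map_mx GRing.inv s)) ^t* = diag_mx (map_mx GRing.inv s).
  apply/matrixP=> i j; rewrite !mxE eq_sym; case: eqP => [->|_].
    by rewrite !mulr1n conj_Creal ?realV.
  by rewrite !mulr0n rmorph0.
have Vu : V \is unitarymx.
  rewrite -trmxC_unitary; apply/unitarymxP; rewrite trmxCK trmxCM hD.
  rewrite mulmxA -(mulmxA (diag_mx _)) MM !mulmx_diag -diag_const_mx.
  by congr diag_mx; apply/rowP=> i; rewrite !mxE -sE; have := sn0 i => sn; field.
(* [w false] and [w true] are the two conjugate unimodular lifts of [s]. *)
pose w (b : bool) : 'rV[C]_n :=
  \row_i (s 0 i + (-1) ^+ b * ('i * sqrtC (1 - e 0 i))).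
have wu b : diag_mx (w b) \is unitarymx.
  apply: unitary_diag_mx => i; rewrite mxE mulrCA.
  apply/eqP; rewrite -(@eqrXn2 _ 2) // expr1n; apply/eqP.
  have tr : sqrtC (1 - e 0 i) \is Num.real.
    by rewrite ger0_real // sqrtC_ge0 subr_ge0.
  rewrite normC2_rect ?rpredM ?rpredX ?rpredN1 //.
  by rewrite exprMn sqrr_sign mul1r sqrtCK expr2 sE addrC subrK.
exists (V *m diag_mx (w false) *m P), (V *m diag_mx (w true) *m P).
split; first by do 2 apply: mul_unitarymx => //.
  by do 2 apply: mul_unitarymx => //.
rewrite -mulmxDl -mulmxDr -raddfD /=.
have -> : w false + w true = 2 *: s.
  by apply/rowP => i; rewrite !mxE; ring.
rewrite -[K]mulmx1 -P'P mulmxA -/M scalemxAl.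
congr (_ *m P); rewrite linearZ /= -scalemxAr scalerA mulVf ?scale1r; last first.
  by rewrite pnatr_eq0.
rewrite /V -mulmxA mulmx_diag.
rewrite -[LHS]mulmx1 -diag_const_mx; congr (_ *m diag_mx _).
by apply/rowP=> i; rewrite !mxE mulVf.
Qed.

(** The triangle inequality for the operator norm, as an identity between
    positive semidefinite matrices. *)
Lemma contraction_shift K a : contraction K -> 0 <= a ->
  contraction ((1 + a)^-1 *: (K + a%:M)).
Proof.
move=> cK a0; have a1 : 1 + a != 0 by rewrite gt_eqF // ltr_pwDl.
rewrite /contraction.
have -> : 1%:M - ((1 + a)^-1 *: (K + a%:M)) ^t* *m ((1 + a)^-1 *: (K + a%:M)) =
    (1 + a)^-1 *: (1%:M - K ^t* *m K) +
    (a / (1 + a) ^+ 2) *: ((1%:M - K) ^t* *m (1%:M - K)).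
  have ar : a^* = a by rewrite geC0_conj.
  have rr : ((1 + a)^-1)^* = (1 + a)^-1 by rewrite geC0_conj // invr_ge0 addr_ge0.
  rewrite trmxCZ rr trmxCD trmxCB trmxC1 tr_scalar_mx map_scalar_mx /= ar.
  rewrite -scalemxAl -scalemxAr !(mulmxDl, mulmxDr, mulNmx, mulmxN).
  rewrite !(mulmx1, mul1mx, mul_scalar_mx, mul_mx_scalar).
  move: (K ^t* *m K) (K ^t*) => KK K'.
  apply/matrixP=> i j; rewrite !mxE; field; exact: a1.
apply: psdmxD; apply: psdmxZ; rewrite ?invr_ge0 ?divr_ge0 ?exprn_ge0 ?addr_ge0 //.
exact: psdmx_gram.
Qed.

(** ** The two moduli, and their values at matrix units *)

Lemma mxmod_psd Z : psdmx (mxmod Z).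
Proof. exact/mxsqrt_psd/psdmx_gram. Qed.

Lemma mxqsym_psd Z : psdmx (mxqsym Z).
Proof. exact/mxsqrt_psd/psdmx_qsym. Qed.

Lemma mxmod_sqr Z : mxmod Z *m mxmod Z = Z ^t* *m Z.
Proof. exact/mxsqrt_sqr/psdmx_gram. Qed.

Lemma mxqsym_sqr Z :
  mxqsym Z *m mxqsym Z = 2^-1 *: (Z ^t* *m Z + Z *m Z ^t*).
Proof. by rewrite mxsqrt_sqr; [rewrite !mxmod_sqr trmxCK | exact: psdmx_qsym]. Qed.

Lemma trmxC_delta i j : (delta_mx i j : 'M[C]_n) ^t* = delta_mx j i.
Proof. by rewrite trmx_delta map_delta_mx. Qed.

Lemma mxmod_delta i j : mxmod (delta_mx i j : 'M[C]_n) = delta_mx j j.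
Proof.
apply: psdmx_sqr_inj; first exact: mxmod_psd.
  by have := psdmx_gram (delta_mx i j : 'M[C]_n); rewrite trmxC_delta mul_delta_mx.
by rewrite mxmod_sqr trmxC_delta !mul_delta_mx.
Qed.

Lemma mxqsym_delta i j (a : C) : i != j -> 0 <= a -> a * a = 2^-1 ->
  mxqsym (delta_mx i j : 'M[C]_n) = a *: (delta_mx i i + delta_mx j j).
Proof.
move=> ij a0 aa; apply: psdmx_sqr_inj; first exact: mxqsym_psd.
  apply: psdmxZ => //; apply: psdmxD.
    by have := psdmx_gram (delta_mx j i : 'M[C]_n); rewrite trmxC_delta mul_delta_mx.
  by have := psdmx_gram (delta_mx i j : 'M[C]_n); rewrite trmxC_delta mul_delta_mx.
rewrite mxqsym_sqr -scalemxAl -scalemxAr scalerA aa; congr (_ *: _).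
have ji : j != i by rewrite eq_sym.
rewrite trmxC_delta mulmxDl !mulmxDr !mul_delta_mx.
rewrite (@mul_delta_mx_0 _ _ _ _ _ _ _ _ ij) (@mul_delta_mx_0 _ _ _ _ _ _ _ _ ji).
by rewrite addr0 add0r addrC.
Qed.

Lemma mxtrace_delta_mul i j Z : \tr (delta_mx j i *m Z) = Z i j.
Proof.
rewrite mxtrace_mulC /mxtrace (bigD1 i) //= big1 => [|k ki].
  rewrite addr0 mxE (bigD1 j) //= big1 => [|l lj].
    by rewrite mxE !eqxx mulr1 addr0.
  by rewrite mxE (negPf lj) mulr0.
by rewrite mxE big1 // => l _; rewrite mxE (negPf ki) andbF mulr0.
Qed.

Lemma mxtrace_delta i : \tr (delta_mx i i : 'M[C]_n) = 1.
Proof. by rewrite -[delta_mx i i]mulmx1 mxtrace_delta_mul mxE eqxx. Qed.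

End Matrices.

(** * Unitarily invariant norms and contractions *)

Section NormBounds.
Set Implicit Arguments.
Unset Strict Implicit.
Local Open Scope sesquilinear_scope.
Local Open Scope complex_scope.
Context {R : realType} {n : nat}.
Notation M := 'M[R[i]]_n.
Implicit Types (K X Y Z : M) (N : M -> R).

Lemma norm_scale_real N (a : R) X : is_norm N -> N (a%:C *: X) = `|a| * N X.
Proof.
move=> nN; apply: complexI; rewrite (norm_scale nN) rmorphM; congr (_ * _).
by rewrite normc_def /= expr0n addr0 sqrtr_sqr.
Qed.

(** Only the eigenvalues of [- K] are to be avoided, and among the [n + 1]
    numbers [e / (k + 1)] one is not a root of the characteristic polynomial. *)
Lemma exists_small_unit_shift K (e : R) : 0 < e ->
  exists a : R, [/\ 0 < a, a <= e & K + (a%:C)%:M \in unitmx].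
Proof.
move=> e0; pose f k : R := e / k.+1%:R.
have f0 k : 0 < f k by rewrite divr_gt0 // ltr0n.
have [[k ku]|nu] := pselect (exists k, K + ((f k)%:C)%:M \in unitmx).
  exists (f k); split=> //.
  by rewrite ler_pdivrMr ?ltr0n // ler_peMr ?(ltW e0) // ler1n.
pose rs := [seq - ((f k)%:C) | k <- iota 0 n.+1].
have : (size rs < size (char_poly K))%N.
  apply: max_poly_roots.
  - by rewrite -size_poly_eq0 size_char_poly.
  - apply/allP => _ /mapP[k _ ->]; rewrite -eigenvalue_root_char.
    have : ~~ row_free (K + ((f k)%:C)%:M).
      by rewrite row_free_unit; apply/negP => ku; apply: nu; exists k.
    by rewrite -kermx_eq0 /eigenvalue /eigenspace !raddfN /= opprK.
  - rewrite map_inj_uniq ?iota_uniq // => k l /oppr_inj/complexI.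
    move/(mulfI (lt0r_neq0 e0))/invr_inj/eqP.
    by rewrite eqr_nat eqSS => /eqP.
by rewrite size_char_poly size_map size_iota ltnn.
Qed.

(** Singular contractions are reached only by perturbation. Unlike
    [contraction], this property is visibly stable under adjunction. *)
Definition nearly_unitary_mean K : Prop := forall e : R, 0 < e ->
  exists a U V, [/\ 0 < a, a <= e, U \is unitarymx, V \is unitarymx &
    K = ((1 + a) / 2)%:C *: (U + V) - a%:C *: 1%:M].

Lemma contraction_nearly_unitary_mean K :
  contraction K -> nearly_unitary_mean K.
Proof.
move=> cK e e0; have [a [a0 ae Ku]] := exists_small_unit_shift K e0.
have aC : 0 <= a%:C by rewrite ler0c ltW.
have a1 : 1 + a%:C != 0 by rewrite gt_eqF // ltr_pwDl.
have [|U [V [Uu Vu eK]]] := contraction_unitary_mean (contraction_shift cK aC).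
  by rewrite unitmxZ // unitfE invr_eq0.
exists a, U, V; split=> //; apply/eqP; rewrite eq_sym subr_eq scalemx1; apply/eqP.
have -> : ((1 + a) / 2)%:C = (1 + a%:C) * 2^-1.
  by rewrite rmorphM rmorphD rmorph1 fmorphV rmorph_nat.
by rewrite -scalerA -eK scalerA mulfV // scale1r.
Qed.

Lemma nearly_unitary_mean_adj K :
  nearly_unitary_mean K -> nearly_unitary_mean (K ^t*).
Proof.
move=> mK e e0; have [a [U [V [a0 ae Uu Vu ->]]]] := mK e e0.
exists a, (U ^t*), (V ^t*).
split; [exact: a0 | exact: ae | exact: unitarymx_trmxC | exact: unitarymx_trmxC | ].
have rC (b : R) : 0 <= b -> (b%:C)^*%R = b%:C.
  by move=> b0; rewrite geC0_conj // ler0c.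
by rewrite trmxCB !trmxCZ trmxCD trmxC1 !rC //; lra.
Qed.

(** For each [a] the decomposition gives [N W <= (1 + 2 a) N X], and [a] is
    arbitrarily small. *)
Lemma norm_le_approx N W X : is_norm N ->
  (forall e : R, 0 < e -> exists a Y1 Y2, [/\ 0 < a, a <= e, N Y1 = N X, N Y2 = N X
     & W = ((1 + a) / 2)%:C *: (Y1 + Y2) - a%:C *: X]) ->
  N W <= N X.
Proof.
move=> nN app; apply/ler_addgt0Pr => e e0.
have N0 := norm_ge0 nN X.
have d0 : 0 < e / (2 * N X + 1) by rewrite divr_gt0 //; lra.
have [a [Y1 [Y2 [a0 ae eY1 eY2 ->]]]] := app _ d0.
have : a * (2 * N X + 1) <= e by rewrite -ler_pdivlMr //; lra.
rewrite -scaleNr -rmorphN.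
have := norm_triangle nN (((1 + a) / 2)%:C *: (Y1 + Y2)) ((- a)%:C *: X).
have := norm_triangle nN Y1 Y2.
rewrite !norm_scale_real // normrN !ger0_norm ?eY1 ?eY2; [|lra..].
move: (N (Y1 + Y2)) (N _) => s t st ts; move: (N X) N0 st ts => x; nra.
Qed.

Lemma unitarily_invariant_mull N U X :
  unitarily_invariant N -> U \is unitarymx -> N (U *m X) = N X.
Proof.
move=> uN Uu; rewrite -[U *m X]mulmx1; apply: (uN _ _ _ Uu).
by apply/unitarymxP; rewrite trmxC1 mulmx1.
Qed.

Lemma unitarily_invariant_mulr N U X :
  unitarily_invariant N -> U \is unitarymx -> N (X *m U) = N X.
Proof.
move=> uN Uu; rewrite -[X *m U]mul1mx mulmxA; apply: (uN _ _ _ _ Uu).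
by apply/unitarymxP; rewrite trmxC1 mulmx1.
Qed.

Lemma nearly_unitary_mean_mull N K X : is_norm N -> unitarily_invariant N ->
  nearly_unitary_mean K -> N (K *m X) <= N X.
Proof.
move=> nN uN mK; apply: norm_le_approx => // e e0.
have [a [U [V [a0 ae Uu Vu ->]]]] := mK e e0.
exists a, (U *m X), (V *m X).
split=> //; try exact: unitarily_invariant_mull.
by rewrite mulmxBl -!scalemxAl mul1mx mulmxDl.
Qed.

Lemma nearly_unitary_mean_mulr N K X : is_norm N -> unitarily_invariant N ->
  nearly_unitary_mean K -> N (X *m K) <= N X.
Proof.
move=> nN uN mK; apply: norm_le_approx => // e e0.
have [a [U [V [a0 ae Uu Vu ->]]]] := mK e e0.
exists a, (X *m U), (X *m V).
split=> //; try exact: unitarily_invariant_mulr.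
by rewrite mulmxBr -!scalemxAr mulmx1 mulmxDr.
Qed.

(** With [A = |Z|] and [T] equal to [sqrt 2] times the quadratic symmetric
    modulus, [A^2 = Z^* Z] and [T^2 = Z^* Z + Z Z^*]. Factoring through [A]
    gives [Z = K A] and [A = K^* Z]; factoring through [T] gives [Z = L T] and
    [T = L^* Z + L'^* Z^*]. Hence [N A = N Z <= N T], while [Z^* = A K^*] shows
    [N (Z^* ) <= N A] and [N T <= N Z + N (Z^* ) <= 2 N A]. *)
Lemma mxqsym_bounds N Z : is_norm N -> unitarily_invariant N ->
  Num.sqrt 2 / 2 * N (mxmod Z) <= N (mxqsym Z) /\
  N (mxqsym Z) <= Num.sqrt 2 * N (mxmod Z).
Proof.
move=> nN uN.
pose r : R := Num.sqrt 2.
have r0 : 0 < r by rewrite sqrtr_gt0.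
have rr : r * r = 2 by rewrite -expr2 sqr_sqrtr.
pose A := mxmod Z; pose T := r%:C *: mxqsym Z.
have NT : N T = r * N (mxqsym Z) by rewrite norm_scale_real // gtr0_norm.
have psdA : psdmx A := mxmod_psd Z.
have psdT : psdmx T by apply: psdmxZ (mxqsym_psd Z); rewrite ler0c ltW.
have eA : A *m A = Z ^t* *m Z + 0 ^t* *m (0 : M).
  by rewrite (mxmod_sqr Z) mulmx0 addr0.
have rC : r%:C * r%:C * 2^-1 = 1.
  by rewrite -rmorphM rr rmorph_nat mulfV // pnatr_eq0.
have eT : T *m T = Z ^t* *m Z + Z ^t* ^t* *m Z ^t*.
  rewrite -scalemxAl -scalemxAr scalerA mxqsym_sqr scalerA rC scale1r.
  by rewrite (trmxCK Z).
have [K [K0 [/contraction_nearly_unitary_mean cK _ ZA _ AZ]]] :=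
  douglas_factorization psdA eA.
have [L [L' [/contraction_nearly_unitary_mean cL
  /contraction_nearly_unitary_mean cL' ZT _ TZ]]] := douglas_factorization psdT eT.
have NA : N A <= N Z.
  rewrite AZ mulmx0 addr0; apply: nearly_unitary_mean_mull => //.
  exact: nearly_unitary_mean_adj.
have NZT : N Z <= N T by rewrite ZT; apply: nearly_unitary_mean_mull.
have NZ : N Z <= N A by rewrite ZA; apply: nearly_unitary_mean_mull.
have NZ' : N (Z ^t*) <= N A.
  rewrite ZA trmxCM psdA.1; apply: nearly_unitary_mean_mulr => //.
  exact: nearly_unitary_mean_adj.
have NTZ : N T <= N Z + N (Z ^t*).
  rewrite TZ; apply: (le_trans (norm_triangle nN _ _)).
  by apply: lerD; apply: nearly_unitary_mean_mull => //;
    apply: nearly_unitary_mean_adj.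
rewrite -/r -/A; rewrite NT in NTZ NZT.
move: (N A) (N Z) (N (Z ^t*)) (N (mxqsym Z)) NA NZT NZ NZ' NTZ => a z z' q.
by move=> *; split; rewrite -(ler_pM2l r0); nra.
Qed.
End NormBounds.

(** * Norms defined by duality *)

Section DualNorm.
Set Implicit Arguments.
Unset Strict Implicit.
Local Open Scope sesquilinear_scope.
Local Open Scope complex_scope.
Local Open Scope classical_set_scope.
Context {R : realType} {n : nat}.
Notation M := 'M[R[i]]_n.+1.
Implicit Types (K X Y Z U V : M) (D : M -> Prop).

Lemma normC_normc (x : R[i]) : `|x| = (normc x)%:C.
Proof. by []. Qed.

Lemma normc_ge0 (x : R[i]) : 0 <= normc x.
Proof. by rewrite -ler0c -normC_normc. Qed.

(** Duality for the pairing [tr (K Z)] turns a bounded set of matrices into a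
    norm: the trace norm when [D] is the set of contractions, the operator norm
    when [D] consists of the [x y] with [x], [y] in the Euclidean unit balls. *)
Definition dual_norm D Z : R := sup [set normc (\tr (K *m Z)) | K in D].

(** Bounded entries make the supremum finite, the matrix units separate points,
    and bi-invariance of [D] passes to the norm. *)
Record dual_ball D : Prop := DualBall {
  dual_ball_entry : forall K i j, D K -> `|K i j| <= 1;
  dual_ball_delta : forall i j, D (delta_mx i j);
  dual_ball_unitary : forall K U V,
    U \is unitarymx -> V \is unitarymx -> D K -> D (U *m K *m V) }.

Lemma dual_norm_le D Z (c : R) : dual_ball D ->
  (forall K, D K -> normc (\tr (K *m Z)) <= c) -> dual_norm D Z <= c.
Proof.
move=> bD le_c; apply: ge_sup => [|_ [K DK <-]]; last exact: le_c.
by exists (normc (\tr (delta_mx 0 0 *m Z))), (delta_mx 0 0) => //;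
  apply: dual_ball_delta.
Qed.

Lemma le_dual_norm D K Z : dual_ball D -> D K ->
  normc (\tr (K *m Z)) <= dual_norm D Z.
Proof.
move=> bD DK; apply: ub_le_sup; last by exists K.
exists (\sum_i \sum_j normc (Z j i)) => _ [L DL <-].
rewrite -lecR -normC_normc /mxtrace rmorph_sum /=.
apply: (le_trans (ler_norm_sum _ _ _)); apply: ler_sum => i _.
rewrite mxE rmorph_sum /=; apply: (le_trans (ler_norm_sum _ _ _)).
apply: ler_sum => j _; rewrite normrM -normC_normc ler_piMl //.
exact: dual_ball_entry DL.
Qed.

Lemma dual_norm_is_norm D : dual_ball D -> is_norm (dual_norm D).
Proof.
move=> bD.
have scale_le (a : R[i]) Z : dual_norm D (a *: Z) <= normc a * dual_norm D Z.
  apply: dual_norm_le => // K DK; rewrite -scalemxAr linearZ /= normcM.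
  by rewrite ler_wpM2l ?le_dual_norm // normc_ge0.
have ge0 Z : 0 <= dual_norm D Z.
  apply: le_trans (le_dual_norm Z bD (dual_ball_delta bD 0 0)).
  exact: normc_ge0.
split=> //.
- move=> Z Z0; apply/matrixP => i j; rewrite mxE.
  apply: eq0_normc; apply/eqP; rewrite eq_le normc_ge0 andbT -Z0.
  rewrite -mxtrace_delta_mul.
  exact: (le_dual_norm Z bD (dual_ball_delta bD j i)).
- move=> a Z; rewrite normC_normc -rmorphM; congr (_ %:C).
  apply/eqP; rewrite eq_le scale_le /=.
  have [->|a0] := eqVneq a 0; first by rewrite normc0 mul0r ge0.
  have := scale_le a^-1 (a *: Z); rewrite scalerA mulVf // scale1r normcV.
  have na : 0 < normc a by rewrite -ltcR -normC_normc normr_gt0.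
  by rewrite [normc a * _]mulrC -ler_pdivlMr // mulrC.
- move=> Z W; apply: dual_norm_le => // K DK.
  rewrite mulmxDr linearD; apply: (le_trans (le_normcD _ _)).
  by apply: lerD; apply: le_dual_norm.
Qed.

Lemma dual_norm_unitarily_invariant D :
  dual_ball D -> unitarily_invariant (dual_norm D).
Proof.
move=> bD.
have le_inv Z U V : U \is unitarymx -> V \is unitarymx ->
    dual_norm D (U *m Z *m V) <= dual_norm D Z.
  move=> Uu Vu; apply: dual_norm_le => // K DK.
  have -> : \tr (K *m (U *m Z *m V)) = \tr (V *m K *m U *m Z).
    by rewrite !mulmxA mxtrace_mulC !mulmxA.
  by apply: le_dual_norm => //; apply: dual_ball_unitary.
move=> Z U V Uu Vu; apply: le_anti; rewrite (le_inv Z U V Uu Vu) /=.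
have := le_inv (U *m Z *m V) _ _ (unitarymx_trmxC Uu) (unitarymx_trmxC Vu).
rewrite !mulmxA -(mulmxA _ V) (unitarymxP Vu) mulmx1.
by rewrite (unitarymx_trmxCmul Uu) mul1mx.
Qed.

Lemma dual_ball_contraction : dual_ball contraction.
Proof.
split.
- move=> K i j cK; have := psdmx_diag_ge0 j cK.
  rewrite mxE mxE eqxx mulr1n [(- _ : M) _ _]mxE gram_diag subr_ge0 (bigD1 i) //= => le1.
  rewrite -(@expr_le1 _ 2) //; apply: le_trans le1.
  by rewrite lerDl sumr_ge0 // => k _; rewrite exprn_ge0.
- move=> i j; rewrite /contraction trmx_delta map_delta_mx mul_delta_mx.
  have -> : 1%:M - delta_mx j j =
      (1%:M - delta_mx j j : M) ^t* *m (1%:M - delta_mx j j).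
    rewrite trmxCB trmxC1 trmx_delta map_delta_mx.
    by rewrite mulmxBr mulmx1 mulmxBl mul1mx mul_delta_mx subrr subr0.
  exact: psdmx_gram.
- move=> K U V Uu Vu cK; rewrite /contraction !trmxCM.
  have U'U := unitarymx_trmxCmul Uu.
  have V'V := unitarymx_trmxCmul Vu.
  have -> : 1%:M - V ^t* *m (K ^t* *m U ^t*) *m (U *m K *m V) =
      V ^t* *m (1%:M - K ^t* *m K) *m V ^t* ^t*.
    rewrite trmxCK mulmxBr mulmx1 mulmxBl V'V; congr (_ - _).
    by rewrite !mulmxA -(mulmxA _ _ U) U'U mulmx1.
  exact: psdmx_conj.
Qed.

Definition unit_rank_one K : Prop := exists (x : 'cV[R[i]]_n.+1) (y : 'rV[R[i]]_n.+1),
  [/\ \sum_i `|x i 0| ^+ 2 <= 1, \sum_i `|y 0 i| ^+ 2 <= 1 & K = x *m y].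

Lemma rV_gram (y : 'rV[R[i]]_n.+1) : \sum_i `|y 0 i| ^+ 2 = (y *m y ^t*) 0 0.
Proof. by rewrite mxE; apply: eq_bigr => i _; rewrite normCK !mxE. Qed.

Lemma dual_ball_unit_rank_one : dual_ball unit_rank_one.
Proof.
split.
- move=> _ i j [x [y [x1 y1 ->]]]; rewrite mxE big_ord1 normrM mulr_ile1 //.
    rewrite -(@expr_le1 _ 2) //; apply: le_trans x1; rewrite (bigD1 i) //=.
    by rewrite lerDl sumr_ge0 // => k _; rewrite exprn_ge0.
  rewrite -(@expr_le1 _ 2) //; apply: le_trans y1; rewrite (bigD1 j) //=.
  by rewrite lerDl sumr_ge0 // => k _; rewrite exprn_ge0.
- move=> i j; exists (delta_mx i 0), (delta_mx 0 j).
  rewrite -gram_diag rV_gram !trmx_delta !map_delta_mx !mul_delta_mx.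
  by rewrite !mxE !eqxx; split.
- move=> _ U V Uu Vu [x [y [x1 y1 ->]]]; exists (U *m x), (y *m V).
  have U'U := unitarymx_trmxCmul Uu.
  rewrite -gram_diag rV_gram !trmx_mul !map_mxM !mulmxA -(mulmxA _ _ U) U'U mulmx1.
  by rewrite -(mulmxA _ V) (unitarymxP Vu) mulmx1 gram_diag -rV_gram; split.
Qed.

(** The identity is the contraction that pairs best with a positive diagonal. *)
Lemma trace_norm_diag (i j : 'I_n.+1) (a : R) : 0 <= a ->
  2 * a <= dual_norm contraction (a%:C *: (delta_mx i i + delta_mx j j)).
Proof.
move=> a0; have c1 : contraction (1%:M : M).
  rewrite /contraction trmxC1 mulmx1 subrr.
  by rewrite -[0 : M](mulmx0 _ ((0 : M) ^t*)); exact: psdmx_gram.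
apply: le_trans (le_dual_norm _ dual_ball_contraction c1).
rewrite mul1mx linearZ linearD /= !mxtrace_delta normcM.
have -> : normc (1 + 1 : R[i]) = 2.
  by apply: complexI; rewrite -normC_normc -[1 + 1]/(2%:R) normr_nat rmorph_nat.
have -> : normc a%:C = a by apply: complexI; rewrite -normC_normc ger0_norm ?ler0c.
by rewrite mulrC.
Qed.

Lemma trace_norm_delta (i : 'I_n.+1) :
  dual_norm contraction (delta_mx i i : M) <= 1.
Proof.
apply: dual_norm_le => [|K cK]; first exact: dual_ball_contraction.
rewrite mxtrace_mulC mxtrace_delta_mul -lecR -normC_normc.
exact: dual_ball_entry dual_ball_contraction _ _ _ cK.
Qed.

Lemma ge1_dual_norm_delta D (i : 'I_n.+1) :
  dual_ball D -> 1 <= dual_norm D (delta_mx i i).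
Proof.
move=> bD; have := le_dual_norm (delta_mx i i) bD (dual_ball_delta bD i i).
by rewrite mxtrace_delta_mul mxE !eqxx normc1.
Qed.

(** Pairing with [x y] gives [a (x_i y_i + x_j y_j)], at most [a] in modulus by
    the arithmetic-geometric mean inequality. *)
Lemma operator_norm_diag (i j : 'I_n.+1) (a : R) : i != j -> 0 <= a ->
  dual_norm unit_rank_one (a%:C *: (delta_mx i i + delta_mx j j) : M) <= a.
Proof.
move=> ij a0; apply: dual_norm_le => [|_ [x [y [x1 y1 ->]]]].
  exact: dual_ball_unit_rank_one.
rewrite -scalemxAr linearZ /= mulmxDr linearD /= !(mxtrace_mulC _ (delta_mx _ _)).
rewrite !mxtrace_delta_mul -lecR -normC_normc normrM ger0_norm ?ler0c //.
rewrite ler_piMr ?ler0c // !mxE !big_ord1.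
have amgm (u v : R[i]) : `|u * v| <= 2^-1 * (`|u| ^+ 2 + `|v| ^+ 2).
  rewrite -subr_ge0 normrM.
  have -> : 2^-1 * (`|u| ^+ 2 + `|v| ^+ 2) - `|u| * `|v| =
      2^-1 * (`|u| - `|v|) ^+ 2 by field.
  by rewrite mulr_ge0 ?invr_ge0 ?ler0n // real_exprn_even_ge0 // rpredB ?normr_real.
have two (f : 'I_n.+1 -> R[i]) : \sum_k `|f k| ^+ 2 <= 1 ->
    `|f i| ^+ 2 + `|f j| ^+ 2 <= 1.
  rewrite (bigD1 i) //= (bigD1 j) 1?eq_sym //= addrA; apply: le_trans.
  by rewrite lerDl sumr_ge0 // => k _; rewrite exprn_ge0.
apply: (le_trans (ler_normD _ _)); apply: (le_trans (lerD (amgm _ _) (amgm _ _))).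
rewrite -mulrDr addrACA -[leRHS](mulVf (_ : 2 != 0)) ?pnatr_eq0 //.
rewrite ler_pM2l ?invr_gt0 ?ltr0n //.
exact: lerD (two (x^~ 0) x1) (two (y 0) y1).
Qed.

End DualNorm.

(** * Sharpness of the constants *)

Section Sharpness.
Set Implicit Arguments.
Unset Strict Implicit.
Local Open Scope complex_scope.
Context {R : realType} {n : nat}.
Notation M := 'M[R[i]]_n.+2.

Lemma half_sqrt2 : exists a : R,
  [/\ a = Num.sqrt 2 / 2, 0 <= a & a%:C * a%:C = 2^-1].
Proof.
exists (Num.sqrt 2 / 2); split=> //; first by rewrite divr_ge0 ?sqrtr_ge0.
have rr : Num.sqrt 2 * Num.sqrt 2 = 2 :> R by rewrite -expr2 sqr_sqrtr.
rewrite -rmorphM; have -> : Num.sqrt 2 / 2 * (Num.sqrt 2 / 2) = 2^-1 :> R by nra.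
by rewrite fmorphV rmorph_nat.
Qed.

Lemma lower_constant_attained : exists (N : M -> R) (Z : M),
  [/\ is_norm N, unitarily_invariant N, 0 < N (mxmod Z) &
    N (mxqsym Z) <= Num.sqrt 2 / 2 * N (mxmod Z)].
Proof.
have [a [ea a0 aa]] := half_sqrt2.
have aC : 0 <= a%:C by rewrite ler0c.
have ij : (0 : 'I_n.+2) != 1 by [].
have bD := @dual_ball_unit_rank_one R n.+1.
exists (dual_norm unit_rank_one), (delta_mx 0 1).
rewrite mxmod_delta (mxqsym_delta ij aC aa) -ea.
have ge1 := ge1_dual_norm_delta (1 : 'I_n.+2) bD.
split; [exact: dual_norm_is_norm | exact: dual_norm_unitarily_invariant | | ].
  exact: lt_le_trans ltr01 ge1.
apply: (le_trans (operator_norm_diag ij a0)).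
by rewrite ler_peMr.
Qed.

Lemma upper_constant_attained : exists (N : M -> R) (Z : M),
  [/\ is_norm N, unitarily_invariant N, 0 < N (mxmod Z) &
    Num.sqrt 2 * N (mxmod Z) <= N (mxqsym Z)].
Proof.
have [a [ea a0 aa]] := half_sqrt2.
have aC : 0 <= a%:C by rewrite ler0c.
have ij : (0 : 'I_n.+2) != 1 by [].
have bD := @dual_ball_contraction R n.+1.
exists (dual_norm contraction), (delta_mx 0 1).
rewrite mxmod_delta (mxqsym_delta ij aC aa).
have ge1 := ge1_dual_norm_delta (1 : 'I_n.+2) bD.
split; [exact: dual_norm_is_norm | exact: dual_norm_unitarily_invariant | | ].
  exact: lt_le_trans ltr01 ge1.
apply: le_trans (trace_norm_diag 0 1 a0).
have -> : 2 * a = Num.sqrt 2 by rewrite ea mulrC divfK // pnatr_eq0.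
by rewrite ler_piMr ?sqrtr_ge0 ?trace_norm_delta.
Qed.

End Sharpness.

Theorem theorem1p2 (R : realType) (n : nat) (hn : (2 <= n)%N) :
  (forall N : 'M[R[i]]_n -> R, is_norm N -> unitarily_invariant N ->
     forall Z : 'M[R[i]]_n,
       Num.sqrt 2 / 2 * N (mxmod Z) <= N (mxqsym Z) /\
       N (mxqsym Z) <= Num.sqrt 2 * N (mxmod Z)) /\
  (forall c : R,
     (forall N : 'M[R[i]]_n -> R, is_norm N -> unitarily_invariant N ->
        forall Z : 'M[R[i]]_n, c * N (mxmod Z) <= N (mxqsym Z)) ->
     c <= Num.sqrt 2 / 2) /\
  (forall C : R,
     (forall N : 'M[R[i]]_n -> R, is_norm N -> unitarily_invariant N ->
        forall Z : 'M[R[i]]_n, N (mxqsym Z) <= C * N (mxmod Z)) ->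
     Num.sqrt 2 <= C).
Proof.
split; first by move=> N nN uN Z; exact: mxqsym_bounds.
case: n hn => [|[|m]] // _.
split=> c bound.
  have [N [Z [nN uN N0 leN]]] := @lower_constant_attained R m.
  by rewrite -(ler_pM2r N0); exact: le_trans (bound N nN uN Z) leN.
have [N [Z [nN uN N0 leN]]] := @upper_constant_attained R m.
by rewrite -(ler_pM2r N0); exact: le_trans leN (bound N nN uN Z).
Qed.
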